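(* Let $N\ge 2$, $X>0$, and let $g_1,\dots,g_N:[0,\infty)\to[0,\infty)$ be productivity functions (zero at $0$, non-decreasing, concave, differentiable on $(0,\infty)$), all of them curved at the origin, i.e. $\frac{g_i(x)}{x}>g_i'(x)$ for all $x>0$. Put $f_i(x)=g_i(x)/x$ for $x>0$ and $f_i(0)=\lim_{x\to0^+}f_i(x)\in(0,\infty]$, and suppose that $$f_i(0)>f_j\Big(\frac{X}{N-1}\Big)\quad\text{for all } i\neq j .$$ Let $x^\sharp=(x_1^\sharp,\dots,x_N^\sharp)$ be the (unique) vector with $x_i^\sharp>0$ for all $i$, $\sum_i x_i^\sharp=X$, and $f_i(x_i^\sharp)=\frac1\lambda$ for all $i$, for some $\lambda>0$ independent of $i$. Let $x^0\in\mathbb{R}^N$ satisfy $x_i^0>0$ for all $i$ and $\sum_i x_i^0=X$, and define recursively (the ''rule of three'') $$x_i^{k+1}=X\,\frac{g_i(x_i^k)}{\sum_{j=1}^N g_j(x_j^k)},\qquad i=1,\dots,N,\ k\ge0 .$$ Then $x^k$ converges to $x^\sharp$ exponentially fast: there exist $C>0$ and $\beta\in(0,1)$ (depending on $x^0$ and the $g_i$) such that $\max_i|x_i^k-x_i^\sharp|\le C\beta^k$ for all $k\ge 0$.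
   Context: A productivity function is a function $g:[0,\infty)\to[0,\infty)$ with $g(0)=0$ that is non-decreasing and concave; $g_i(x)$ is the deterministic, time-independent scientific output of research unit $i$ given budget $x$. The budgets are subject only to $x_i\ge0$ and $\sum_i x_i=X$ (''free funding conditions''). Under the stated hypotheses the vector $x^\sharp$ exists and is unique; it is the maximizer of $\sum_i\int_0^{x_i}\frac{g_i(y)}{y}dy$ over nonnegative budgets with sum $X$ (when these integrals are finite). *)

(* Defs.v *)
From mathcomp Require Import all_boot all_order all_algebra.
From mathcomp Require Import all_classical all_reals all_analysis.

Set Implicit Arguments.
Unset Strict Implicit.
Unset Printing Implicit Defensive.

Import Order.TTheory GRing.Theory Num.Theory.
Import numFieldNormedType.Exports.

Local Open Scope classical_set_scope.
Local Open Scope ring_scope.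

(* A function on [0, +oo[ is represented by a total function R -> R whose
   values at negative arguments are never constrained nor used. *)
Record productivity_function (R : realType) (g : R -> R) : Prop := {
  productivity_at0 : g 0 = 0;
  productivity_ge0 : forall x, 0 <= x -> 0 <= g x;
  productivity_nondecreasing : {in `[0, +oo[ &, {homo g : x y / x <= y}};
  productivity_concave :
    convex_function (`[0, +oo[%classic : set R) (fun x => - g x) }.

Definition mean_productivity (R : realType) (g : R -> R) (x : R) : R := g x / x.

(* Taken in \bar R because the limit may be +oo.  It always exists for a
   productivity function, whose mean productivity is nonincreasing on ]0, +oo[. *)
Definition mean_productivity0 (R : realType) (g : R -> R) : \bar R :=
  lim ((mean_productivity g x)%:E @[x --> (0 : R)^'+]).

Definition curved_at_origin (R : realType) (g : R -> R) : Prop :=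
  forall x : R, 0 < x -> derive1 g x < mean_productivity g x.

Definition positive_budget (R : realType) (N : nat) (X : R) (x : 'rV[R]_N) :
  Prop := (forall i, 0 < x 0 i) /\ \sum_i x 0 i = X.

Definition balanced_budget (R : realType) (N : nat) (X : R)
    (g : 'I_N -> R -> R) (x : 'rV[R]_N) : Prop :=
  positive_budget X x /\
  exists2 lambda : R, 0 < lambda
    & forall i, mean_productivity (g i) (x 0 i) = 1 / lambda.

Definition rule_of_three (R : realType) (N : nat) (X : R)
    (g : 'I_N -> R -> R) (x : 'rV[R]_N) : 'rV[R]_N :=
  \row_i (X * (g i (x 0 i) / \sum_j g j (x 0 j))).

(* Main.v *)
Require Import Defs.
From mathcomp Require Import all_boot all_order all_algebra.
From mathcomp Require Import all_classical all_reals all_analysis.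
From mathcomp Require Import ring lra.

Set Implicit Arguments.
Unset Strict Implicit.
Unset Printing Implicit Defensive.

Import Order.TTheory GRing.Theory Num.Theory.
Import numFieldNormedType.Exports.

Local Open Scope classical_set_scope.
Local Open Scope ring_scope.

(* Convergence.  Measure the distance from u to the balanced budget xs by the
   spread E of the ratios r_i = u_i / xs_i, the least E with r_i <= (1 + E) r_j
   for all i, j.  It ignores the normalization in the rule of three, which
   therefore acts on the ratios as r_i |-> phi_i(r_i) with
   phi_i(r) = g_i(r xs_i) / g_i(xs_i).  This phi_i is nondecreasing and concave
   with phi_i(1) = 1 and, by curvature, phi_i(b) > b for b < 1.  Concavity bounds
   phi_i by its chord through b and 1, whose slope is some s < 1: from below on
   [b, 1], from above on [1, +oo[.  Since 1 lies between the extreme ratios, one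
   step multiplies E by s.

   Existence of xs.  Each f_i restricted to [e, X] extends to a decreasing
   homeomorphism of R, so the sum of the inverses is continuous and takes the
   value X at some common level c.  The hypothesis on f_i(0) provides an e with
   f_j(X / (N - 1) - 2 e) < f_i(e); if some coordinate were at most e, the
   others would be at most X / (N - 1) - 2 e, and the total would fall short
   of X. *)

(** * Productivity functions and their mean productivity *)

Lemma productivity_conv (R : realType) (g : R -> R) (a b t : R) :
  productivity_function g -> 0 <= a -> 0 <= b -> 0 <= t <= 1 ->
  t * g a + (1 - t) * g b <= g (t * a + (1 - t) * b).
Proof.
move=> [_ _ _ cg] a0 b0 /andP[t0 t1].
have ha : a \in (`[0, +oo[%classic : set R) by rewrite inE/= in_itv/= a0.
have hb : b \in (`[0, +oo[%classic : set R) by rewrite inE/= in_itv/= b0.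
have := cg (Itv01 t0 t1) a b ha hb.
by rewrite !convRE/= !mulrN -opprD lerN2.
Qed.

Section productivity.
Context {R : realType} (g : R -> R).
Hypothesis g_prod : productivity_function g.
Hypothesis g_diff : forall x : R, 0 < x -> derivable g x 1.
Hypothesis g_curved : curved_at_origin g.

Let f := mean_productivity g.

Lemma productivity_le x y : 0 <= x -> x <= y -> g x <= g y.
Proof.
move=> x0 xy; apply: (productivity_nondecreasing g_prod) => //;
  by rewrite in_itv/= ?x0// (le_trans x0 xy).
Qed.

(** The quotient rule, arranged so that curvature at the origin fixes the sign. *)
Lemma mean_productivity_is_derive (x : R) : 0 < x ->
  is_derive x 1 f ((derive1 g x - f x) / x).
Proof.
move=> x0; have xn0 : x != 0 by rewrite gt_eqF.
have dg : is_derive x 1 g (derive1 g x).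
  by rewrite derive1E; apply: derivableP; exact: g_diff.
have di : is_derive x 1 (fun y : R => y^-1) (- x ^- 2 * 1).
  exact: (is_deriveV (f := id)).
apply: is_derive_eq.
rewrite /f /mean_productivity /GRing.scale/=. by field.
Qed.

Lemma mean_productivity_continuous (x : R) : 0 < x -> {for x, continuous f}.
Proof.
move=> x0; apply/differentiable_continuous/derivable1_diffP.
by have [] := mean_productivity_is_derive x0.
Qed.

Lemma mean_productivity_lt (x y : R) : 0 < x -> x < y -> f y < f x.
Proof.
move=> x0 xy.
have zpos z : z \in `]x / 2, y + 1[ -> 0 < z.
  by rewrite in_itv/= => /andP[/(lt_trans _)-> //]; rewrite divr_gt0.
apply: (@ltr0_derive1_lt_oo _ f (x / 2) (y + 1)) => //.
- by move=> z /zpos z0; have [] := mean_productivity_is_derive z0.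
- move=> z /zpos z0; rewrite derive1E.
  have [_ ->] := mean_productivity_is_derive z0.
  by rewrite pmulr_llt0 ?invr_gt0// subr_lt0; exact: g_curved.
- by move=> z /set_mem/zpos z0; exact: mean_productivity_continuous.
- by rewrite in_itv/=; apply/andP; split; lra.
- by rewrite in_itv/=; apply/andP; split; lra.
Qed.

Lemma mean_productivity_le (x y : R) : 0 < x -> x <= y -> f y <= f x.
Proof.
by move=> x0; rewrite le_eqVlt => /predU1P[->//|/(mean_productivity_lt x0)/ltW].
Qed.

Lemma mean_productivity_inj (x y : R) : 0 < x -> 0 < y -> f x = f y -> x = y.
Proof.
move=> x0 y0 fxy; have [xy|yx|//] := ltgtP x y.
  by have := mean_productivity_lt x0 xy; rewrite fxy ltxx.
by have := mean_productivity_lt y0 yx; rewrite fxy ltxx.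
Qed.

(** If [g] vanished at [x], the strictly decreasing [f] would be negative at [x + 1]. *)
Lemma productivity_gt0 (x : R) : 0 < x -> 0 < g x.
Proof.
move=> x0; rewrite lt_neqAle (productivity_ge0 g_prod (ltW x0)) andbT.
apply/eqP => gx0.
have := mean_productivity_lt x0 (_ : x < x + 1).
rewrite /f /mean_productivity -gx0 mul0r ltrDl ltr01 => /(_ isT).
apply/negP; rewrite -leNgt divr_ge0//; last by lra.
by apply: (productivity_ge0 g_prod); lra.
Qed.

Lemma mean_productivity_gt0 (x : R) : 0 < x -> 0 < f x.
Proof. by move=> x0; rewrite divr_gt0// productivity_gt0. Qed.

(* The slope of g between b y and y, divided by f y, serves as s. *)
Lemma productivity_chord (y b : R) : 0 < y -> 0 < b -> b < 1 ->
  exists s : R, [/\ 0 <= s, s < 1,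
    forall r, 1 <= r -> g (r * y) <= (1 + s * (r - 1)) * g y &
    forall r, b <= r -> r <= 1 -> (1 - s * (1 - r)) * g y <= g (r * y)].
Proof.
move=> y0 b0 b1.
have gy0 := productivity_gt0 y0.
have b1' : 0 < 1 - b by rewrite subr_gt0.
have by0 : 0 < b * y by rewrite mulr_gt0.
have byy : b * y < y by rewrite gtr_pMl.
have gb1 : g (b * y) <= g y by apply: productivity_le; exact: ltW.
(* Strict decrease of [f] from [b * y] to [y]; this is what makes [s < 1]. *)
have gb2 : b * g y < g (b * y).
  have := mean_productivity_lt by0 byy.
  rewrite /f /mean_productivity ltr_pdivrMr//.
  by rewrite (_ : g (b * y) / (b * y) * y = g (b * y) / b); last (by field; lra);
     rewrite ltr_pdivlMr// mulrC.
pose s := (g y - g (b * y)) / ((1 - b) * g y).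
have sE : s * (1 - b) * g y = g y - g (b * y) by rewrite /s; field; lra.
exists s; split.
- by rewrite divr_ge0 ?subr_ge0// mulr_ge0 ?ltW.
- by rewrite ltr_pdivrMr ?mulr_gt0// mul1r; lra.
- move=> r r1.
  (* With this weight [y] is a convex combination of [r * y] and [b * y], so concavity at [y] bounds
     [g (r * y)] from above. *)
  have t01 : 0 <= (1 - b) / (r - b) <= 1.
    by rewrite divr_ge0 ?ler_pdivrMr ?mul1r/=; lra.
  have ry0 : 0 <= r * y by apply: mulr_ge0; lra.
  have := productivity_conv g_prod ry0 (ltW by0) t01.
  have rb : r - b != 0 by lra.
  rewrite (_ : _ * (r * y) + _ = y); last by field.
  rewrite (_ : 1 - (1 - b) / (r - b) = (r - 1) / (r - b)); last by field.
  rewrite mulrAC (mulrAC (r - 1)) -mulrDl ler_pdivrMr; last by lra.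
  move=> H.
  have : (1 - b) * g (r * y) <= (1 - b) * ((1 + s * (r - 1)) * g y).
    rewrite [leRHS](_ : _ = (1 - b) * g y + (r - 1) * (s * (1 - b) * g y)).
      by rewrite sE; lra.
    by ring.
  by rewrite ler_pM2l.
- move=> r br r1.
  have t01 : 0 <= (r - b) / (1 - b) <= 1.
    by rewrite divr_ge0 ?ler_pdivrMr ?mul1r/=; lra.
  have := productivity_conv g_prod (ltW y0) (ltW by0) t01.
  have rb : 1 - b != 0 by lra.
  rewrite (_ : _ * y + _ = r * y); last by field.
  apply: le_trans; rewrite le_eqVlt; apply/orP; left; apply/eqP.
  by rewrite /s; field; lra.
Qed.

(** If [f] stayed at or below [b] on the positive reals, so would its limit at 0, which exists by
    monotonicity. *)
Lemma mean_productivity0_gt (b : R) :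
  (b%:E < mean_productivity0 g)%E -> exists2 d : R, 0 < d & b < f d.
Proof.
move=> bl; apply: contrapT => H.
suff : (mean_productivity0 g <= b%:E)%E by rewrite leNgt bl.
apply: lime_le.
  apply: nonincreasing_at_right_is_cvge; apply: nearW => z x y.
  rewrite !in_itv/= => /andP[x0 _] _ xy.
  by rewrite lee_fin; exact: mean_productivity_le.
near=> x; rewrite lee_fin leNgt; apply/negP => bx; apply: H; exists x => //.
Unshelve. all: by end_near. Qed.

End productivity.

(** * Contraction of the ratio spread under the rule of three *)

Lemma exists_le_sum (R : realType) (N : nat) (u v : 'I_N -> R) (i : 'I_N) :
  \sum_j u j = \sum_j v j -> exists j, u j <= v j.
Proof.
move=> uv; apply: contrapT => H.
suff : \sum_j v j < \sum_j u j by rewrite uv ltxx.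
apply: ltr_sum; first by apply/hasP; exists i; rewrite ?mem_index_enum.
by move=> j _; rewrite ltNge; apply/negP => uvj; apply: H; exists j.
Qed.

Section dynamics.
Context {R : realType} {N : nat} (X : R) (g : 'I_N -> R -> R).
Hypothesis X_gt0 : 0 < X.
Hypothesis g_prod : forall i, productivity_function (g i).
Hypothesis g_diff : forall (i : 'I_N) (x : R), 0 < x -> derivable (g i) x 1.
Hypothesis g_curved : forall i, curved_at_origin (g i).

Let g_gt0 i x (x_gt0 : 0 < x) : 0 < g i x :=
  productivity_gt0 (g_prod i) (@g_diff i) (g_curved i) x_gt0.

Lemma total_output_gt0 (u : 'rV[R]_N) : positive_budget X u ->
  0 < \sum_j g j (u 0 j).
Proof.
move=> [u0 us].
have [i] : exists i : 'I_N, true.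
  apply: contrapT => H; move: X_gt0; rewrite -us big1 ?ltxx// => i _.
  by exfalso; apply: H; exists i.
move=> _; rewrite (bigD1 i)//= ltr_pwDl// ?g_gt0// sumr_ge0// => j _.
by rewrite ltW// g_gt0.
Qed.

Lemma positive_budget_rule_of_three (u : 'rV[R]_N) :
  positive_budget X u -> positive_budget X (rule_of_three X g u).
Proof.
move=> bu; have S0 := total_output_gt0 bu; case: bu => u0 us; split.
  by move=> i; rewrite mxE mulr_gt0// divr_gt0// g_gt0.
under eq_bigr do rewrite mxE.
by rewrite -mulr_sumr -mulr_suml divff ?mulr1// gt_eqF.
Qed.

Variable xs : 'rV[R]_N.
Hypothesis xs_balanced : balanced_budget X g xs.

(** For positive [u], the least admissible [1 + E] is the exponential of Hilbert's projective
    distance from [u] to [xs]. *)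
Definition ratio_spread (E : R) (u : 'rV[R]_N) :=
  forall i j, u 0 i / xs 0 i <= (1 + E) * (u 0 j / xs 0 j).

Let xs_gt0 i : 0 < xs 0 i := xs_balanced.1.1 i.

(** Equal totals force some ratio to be at most 1 and some ratio to be at least 1; the spread
    compares every other ratio with these. *)
Lemma ratio_spread_bounds (E : R) (u : 'rV[R]_N) : 0 <= E ->
  positive_budget X u -> ratio_spread E u -> forall i,
  u 0 i / xs 0 i <= 1 + E /\ 1 <= (1 + E) * (u 0 i / xs 0 i).
Proof.
move=> E0 [u0 us] uE i; have [[_ xss] _] := xs_balanced; split.
  have [k uk] := exists_le_sum i (etrans us (esym xss)).
  apply: le_trans (uE i k) _; rewrite ger_pMr; last by lra.
  by rewrite ler_pdivrMr// mul1r.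
have [k uk] := exists_le_sum i (etrans xss (esym us)).
by apply: le_trans (uE k i); rewrite ler_pdivlMr// mul1r.
Qed.

Lemma ratio_spread_dist (E : R) (u : 'rV[R]_N) : 0 <= E ->
  positive_budget X u -> ratio_spread E u -> forall i,
  `|u 0 i - xs 0 i| <= X * E.
Proof.
move=> E0 bu uE i; have [h1 h2] := ratio_spread_bounds E0 bu uE i.
have xi := xs_gt0 i.
have xX : xs 0 i <= X.
  have [[_ <-] _] := xs_balanced.
  by rewrite (bigD1 i)//= lerDl sumr_ge0// => j _; exact: ltW.
have -> : u 0 i - xs 0 i = xs 0 i * (u 0 i / xs 0 i - 1).
  by field; rewrite gt_eqF.
rewrite normrM gtr0_norm//; apply: ler_pM => //; first exact: ltW.
set r := u 0 i / xs 0 i in h1 h2 *.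
rewrite ler_norml; apply/andP; split; last by lra.
(* Here [1 - r <= E * r], which is at most [E] if [r <= 1]; otherwise [1 - r] is negative. *)
by nra.
Qed.

(* The core estimate: with a = max(r_i, 1) and c = min(r_j, 1), the spread
   hypothesis gives a <= (1 + E) c, and then
   1 + s (a - 1) <= (1 + s E) (1 - s (1 - c))
   because the difference is at least s E (1 - s) (1 - c). *)
Lemma ratio_spread_rule_of_three (E s b : R) (u : 'rV[R]_N) :
  0 <= E -> 0 <= s -> s < 1 -> b * (1 + E) <= 1 ->
  (forall i r, 1 <= r ->
    g i (r * xs 0 i) <= (1 + s * (r - 1)) * g i (xs 0 i)) ->
  (forall i r, b <= r -> r <= 1 ->
    (1 - s * (1 - r)) * g i (xs 0 i) <= g i (r * xs 0 i)) ->
  positive_budget X u -> ratio_spread E u ->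
  ratio_spread (s * E) (rule_of_three X g u).
Proof.
move=> E0 s0 s1 bE gle gge bu uE i j.
have S0 := total_output_gt0 bu.
have [_ [la la0 fla]] := xs_balanced.
have gE k : g k (xs 0 k) = la^-1 * xs 0 k.
  have := fla k; rewrite /mean_productivity mul1r => <-.
  by rewrite divfK// gt_eqF.
have [hi1 _] := ratio_spread_bounds E0 bu uE i.
have [_ hj2] := ratio_spread_bounds E0 bu uE j.
have hij := uE i j.
have uxs k : u 0 k = (u 0 k / xs 0 k) * xs 0 k by rewrite divfK// gt_eqF.
have r0 k : 0 < u 0 k / xs 0 k by rewrite divr_gt0// bu.1.
rewrite !mxE.
set T := \sum__ _ in S0 *.
have [ri0 rj0] := (r0 i, r0 j).
move: hi1 hj2 hij ri0 rj0 (uxs i) (uxs j).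
set ri := u 0 i / xs 0 i; set rj := u 0 j / xs 0 j.
move=> hi1 hj2 hij ri0 rj0 -> ->.
(* The common factor [X / T] is exposed on each side in turn, then cancelled. *)
have -> t k : X * (t / T) / xs 0 k = X / T * (t / xs 0 k) by ring.
have -> t k : X * (t / T) / xs 0 k = X / T * (t / xs 0 k) by ring.
rewrite [leRHS]mulrCA ler_pM2l ?divr_gt0//.
have [a [ria a1 a2 a3]] : exists a, [/\ ri <= a, 1 <= a, a <= 1 + E &
    a <= (1 + E) * rj].
  by have [r1|r1] := leP ri 1; [exists 1 | exists ri]; split => //; lra.
(* If [c] is [rj], then [b <= c] because [b * (1 + E) <= 1 <= (1 + E) * rj]; the chord bound thus
   applies at [c]. *)
have [c [crj c1 c0 c2 c3]] : exists c, [/\ c <= rj, c <= 1, 0 < c, b <= c &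
    a <= (1 + E) * c].
  by have [r1|r1] := leP rj 1; [exists rj | exists 1]; split => //; nra.
have gi : g i (ri * xs 0 i) / xs 0 i <= (1 + s * (a - 1)) * la^-1.
  rewrite ler_pdivrMr// -[leRHS]mulrA -gE; apply: le_trans (gle i a a1).
  apply: productivity_le => //; first by rewrite mulr_ge0// ltW.
  by rewrite ler_pM2r.
have gj : (1 - s * (1 - c)) * la^-1 <= g j (rj * xs 0 j) / xs 0 j.
  rewrite ler_pdivlMr// -[leLHS]mulrA -gE; apply: le_trans (gge j c c2 c1) _.
  apply: productivity_le => //; first by rewrite mulr_ge0// ltW.
  by rewrite ler_pM2r.
apply: le_trans gi _.
have sE0 : 0 <= s * E by rewrite mulr_ge0.
apply: le_trans (ler_wpM2l _ gj); last by lra.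
rewrite mulrA ler_pM2r ?invr_gt0//.
have h1 : s * a <= s * ((1 + E) * c) by rewrite ler_wpM2l.
have h2 : 0 <= s * E * ((1 - s) * (1 - c)) by rewrite !mulr_ge0//; lra.
rewrite -subr_ge0.
by lra.
Qed.

(** Both bounds weaken as the slope grows, so the largest of finitely many slopes serves all
    indices. *)
Lemma uniform_chord (b : R) : 0 < b -> b < 1 ->
  exists s : R, [/\ 0 < s, s < 1,
  forall i r, 1 <= r ->
    g i (r * xs 0 i) <= (1 + s * (r - 1)) * g i (xs 0 i) &
  forall i r, b <= r -> r <= 1 ->
    (1 - s * (1 - r)) * g i (xs 0 i) <= g i (r * xs 0 i)].
Proof.
move=> b0 b1.
have /choice[s sP] i := productivity_chord (g_prod i) (@g_diff i) (g_curved i)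
  (xs_gt0 i) b0 b1.
(* The default [1 / 2] keeps the rate positive even if all slopes vanish. *)
pose t := \big[Num.max/(1 / 2 : R)]_i s i.
have st i : s i <= t by exact: le_bigmax.
exists t; split.
- by apply: lt_le_trans (bigmax_ge_id _ _ _ _); lra.
- by apply: bigmax_lt => [|i _]; [lra | have [] := sP i].
- move=> i r r1; have [_ _ /(_ r r1) h _] := sP i; apply: le_trans h _.
  by rewrite ler_pM2r ?g_gt0// lerD2l ler_wpM2r// subr_ge0.
- move=> i r br r1; have [_ _ _ /(_ r br r1) h] := sP i; apply: le_trans h.
  by rewrite ler_pM2r ?g_gt0// lerD2l lerN2 ler_wpM2r// subr_ge0.
Qed.

Lemma rule_of_three_geometric (x : nat -> 'rV[R]_N) :
  positive_budget X (x 0%N) ->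
  (forall k, x k.+1 = rule_of_three X g (x k)) ->
  exists C beta : R, [/\ 0 < C, 0 < beta, beta < 1 &
    forall k i, `|x k 0 i - xs 0 i| <= C * beta ^+ k].
Proof.
move=> x0 xS.
have xb k : positive_budget X (x k).
  by elim: k => // k ih; rewrite xS; exact: positive_budget_rule_of_three.
pose r i := x 0%N 0 i / xs 0 i.
have r0 i : 0 < r i by rewrite divr_gt0// x0.1.
(* The double sum dominates each [r i / r j]; the added 1 makes [E] positive. *)
pose E := 1 + \sum_i \sum_j r i / r j.
have rr0 i j : 0 <= r i / r j by rewrite divr_ge0// ltW.
have S0 : 0 <= \sum_i \sum_j r i / r j by apply: sumr_ge0 => i _; exact: sumr_ge0.
have E0 : 0 < E by rewrite /E; lra.
(* The spread never exceeds its initial bound [E], so this base point, and hence one slope [s],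
   serves at every step. *)
have b0 : 0 < (1 + E)^-1 by rewrite invr_gt0; lra.
have b1 : (1 + E)^-1 < 1 by rewrite invf_lt1; lra.
have [s [s0 s1 gle gge]] := uniform_chord b0 b1.
exists (X * E), s; split => // [|k i]; first exact: mulr_gt0.
have sE k' : 0 <= s ^+ k' * E by rewrite mulr_ge0// ?exprn_ge0// ltW.
suff H : ratio_spread (s ^+ k * E) (x k).
  by rewrite -mulrA (mulrC E); exact: ratio_spread_dist.
elim: k => [|k ih].
  move=> i1 j1; rewrite expr0 mul1r -/(r i1) -/(r j1) -ler_pdivrMr//.
  suff : r i1 / r j1 <= \sum_i \sum_j r i / r j by rewrite /E; lra.
  rewrite (bigD1 i1)//= (bigD1 j1)//= -addrA lerDl addr_ge0 ?sumr_ge0// => i2 _.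
  exact: sumr_ge0.
rewrite xS exprS -mulrA.
apply: (ratio_spread_rule_of_three _ (ltW s0) s1 _ gle gge) => //.
rewrite mulrC ler_pdivrMr ?mul1r; last by lra.
by rewrite lerD2l ler_piMl ?exprn_ile1 ?ltW.
Qed.

End dynamics.

(** * A common level for decreasing bijections *)

Lemma decreasing_bijection_inverse (R : realType) (F : R -> R) :
  continuous F -> (forall x y, x < y -> F y < F x) ->
  (forall c, exists x, F x = c) ->
  exists G : R -> R, [/\ continuous G, cancel F G & cancel G F].
Proof.
move=> cF dF /choice[G FG].
have GF : cancel F G.
  move=> x; have [lt|lt|//] := ltgtP (G (F x)) x; have := dF _ _ lt;
    by rewrite FG ltxx.
(* Each [c] is a value of [F], so continuity of a local inverse near [F (G c)] suffices. *)
exists G; split => // c; rewrite -[c]FG.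
have cGF : {near F (G c), continuous G}.
  apply: near_can_continuous.
    exact: (@filterE _ (nbhs (G c)) _ _ GF).
  exact: (@filterE _ (nbhs (G c)) _ _ cF).
exact: nbhs_singleton cGF.
Qed.

Lemma common_level (R : realType) (N : nat) (X : R) (F : 'I_N -> R -> R) :
  (0 < N)%N -> (forall i, continuous (F i)) ->
  (forall i x y, x < y -> F i y < F i x) ->
  (forall i c, exists x, F i x = c) ->
  exists (y : 'I_N -> R) (c : R), (forall i, F i (y i) = c) /\ \sum_i y i = X.
Proof.
move=> N0 cF dF sF.
have /choice[G GP] i := decreasing_bijection_inverse (cF i) (dF i) (sF i).
have dG i x y : x <= y -> G i y <= G i x.
  move=> xy; rewrite leNgt; apply/negP => /(dF i).
  by have [_ _ K] := GP i; rewrite !K ltNge xy.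
pose H c := \sum_i G i c.
have cH : continuous H.
  apply: continuous_big; first exact: add_continuous.
  by move=> i _; have [] := GP i.
(* At the equal share [m] every [F i] lies in [[- B, B]]. Hence the inverses are at most [m] at
   level [B] and at least [m] at [- B], so [H] crosses [X] in between. *)
pose m := X / N%:R.
have mX : \sum_(i < N) m = X.
  by rewrite sumr_const card_ord -mulr_natr divfK// pnatr_eq0 -lt0n.
pose B := \sum_i `|F i m|.
have FB i : `|F i m| <= B by rewrite /B (bigD1 i)//= lerDl sumr_ge0.
have GB i : G i B <= m <= G i (- B).
  have [_ K _] := GP i.
  by rewrite -{1 2}(K m) !dG//; have := FB i; rewrite ler_norml => /andP[].
have [c _ Hc] : exists2 c, c \in `[- B, B] & H c = X.
  have B0 : 0 <= B by exact: sumr_ge0.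
  have H1 : H B <= X.
    by rewrite -mX; apply: ler_sum => i _; have /andP[] := GB i.
  have H2 : X <= H (- B).
    by rewrite -mX; apply: ler_sum => i _; have /andP[] := GB i.
  apply: IVT; [lra | exact: continuous_subspaceT |].
  by rewrite ge_min H1 orbT le_max H2.
exists (G^~ c), c; split => // i; by have [_ _] := GP i.
Qed.

(** * Extending a decreasing function from an interval to the line *)

Section clamp.
Context {R : realType} (f : R -> R) (a b : R).
Hypothesis a_gt0 : 0 < a.
Hypothesis ab : a <= b.
Hypothesis f_cont : forall x : R, 0 < x -> {for x, continuous f}.
Hypothesis f_decr : forall x y : R, 0 < x -> x < y -> f y < f x.

Definition clamp (x : R) := Num.max a (Num.min x b).

(* The term x - clamp x makes the extension strictly decreasing, and onto R,
   outside [a, b]. *)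
Definition clamp_extension (x : R) := f (clamp x) - (x - clamp x).

Let clamp_ge x : a <= clamp x.
Proof. by rewrite le_max lexx. Qed.

Lemma clampP x : [\/ x <= a /\ clamp x = a, a <= x <= b /\ clamp x = x |
  b <= x /\ clamp x = b].
Proof.
rewrite /clamp; have [xb|bx] := leP x b.
  by have [ax|xa] := leP a x; [constructor 2 | constructor 1; rewrite ltW].
by rewrite (max_idPr ab); constructor 3; rewrite ltW.
Qed.

Lemma clamp_continuous : continuous clamp.
Proof.
apply: (@max_fun_continuous _ R R (cst a) (id \min cst b)).
  exact: cst_continuous.
by apply: min_fun_continuous; [move=> x; exact: cvg_id | exact: cst_continuous].
Qed.

Lemma clamp_extension_continuous : continuous clamp_extension.
Proof.
move=> x; apply: (@cvgB _ R).
  apply: (@continuous_comp _ _ _ clamp f); first exact: clamp_continuous.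
  by apply: f_cont; exact: lt_le_trans (clamp_ge x).
by apply: (@cvgB _ R); [exact: cvg_id | exact: clamp_continuous].
Qed.

(** Where [clamp] increases, [f] drops and [x - clamp x] does not decrease; where [clamp] is
    constant, the linear term alone drops. *)
Lemma clamp_extension_decr x y :
  x < y -> clamp_extension y < clamp_extension x.
Proof.
move=> xy; rewrite /clamp_extension; have ab' := ab.
have [cxy|->] : clamp x < clamp y \/ clamp x = clamp y.
- have : clamp x <= clamp y.
    by have [[? ->]|[/andP[? ?] ->]|[? ->]] := clampP x;
       have [[? ->]|[/andP[? ?] ->]|[? ->]] := clampP y; lra.
  by rewrite le_eqVlt => /orP[/eqP->|->]; [right|left].
- have := f_decr (lt_le_trans a_gt0 (clamp_ge x)) cxy.
  suff : x - clamp x <= y - clamp y by lra.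
  by have [[? ->]|[/andP[? ?] ->]|[? ->]] := clampP x;
     have [[? ->]|[/andP[? ?] ->]|[? ->]] := clampP y; lra.
- by lra.
Qed.

Lemma clamp_extension_surj c : exists x, clamp_extension x = c.
Proof.
have ab' := ab.
have na := normr_ge0 (c - f a); have nb := normr_ge0 (c - f b).
have ca : clamp (a - `|c - f a|) = a.
  by have [[? ->]|[/andP[? ?] ->]|[? ->]] := clampP (a - `|c - f a|); lra.
have cb : clamp (b + `|c - f b|) = b.
  by have [[? ->]|[/andP[? ?] ->]|[? ->]] := clampP (b + `|c - f b|); lra.
have [x _ <-] : exists2 x, x \in `[a - `|c - f a|, b + `|c - f b|] &
    clamp_extension x = c.
  apply: IVT; [lra | |].
    by apply: continuous_subspaceT; exact: clamp_extension_continuous.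
  rewrite ge_min le_max /clamp_extension ca cb.
  have := ler_norm (c - f a); have := ler_norm (f b - c).
  rewrite (distrC (f b)) => h1 h2.
  by apply/andP; split; apply/orP; [right | left]; lra.
by exists x.
Qed.

End clamp.

(** * Uniqueness and existence of the balanced budget *)

Section balance.
Context {R : realType} {N : nat} (X : R) (g : 'I_N -> R -> R).
Hypothesis N_ge2 : (2 <= N)%N.
Hypothesis X_gt0 : 0 < X.
Hypothesis g_prod : forall i, productivity_function (g i).
Hypothesis g_diff : forall (i : 'I_N) (x : R), 0 < x -> derivable (g i) x 1.
Hypothesis g_curved : forall i, curved_at_origin (g i).

Let f i := mean_productivity (g i).

Let f_lt i x y : 0 < x -> x < y -> f i y < f i x.
Proof. exact: (mean_productivity_lt (@g_diff i) (g_curved i)). Qed.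

(** Equal totals give coordinates comparing in both directions, so the two levels agree, and each
    [f i] is injective. *)
Lemma balanced_budget_unique (x y : 'rV[R]_N) :
  balanced_budget X g x -> balanced_budget X g y -> x = y.
Proof.
move=> [[x0 xs] [l l0 fl]] [[y0 ys] [m m0 fm]].
have xy i : x 0 i <= y 0 i -> 1 / m <= 1 / l.
  rewrite -(fl i) -(fm i).
  exact: (mean_productivity_le (@g_diff i) (g_curved i)).
have yx i : y 0 i <= x 0 i -> 1 / l <= 1 / m.
  rewrite -(fl i) -(fm i).
  exact: (mean_productivity_le (@g_diff i) (g_curved i)).
apply/rowP => i.
have [j /xy ml] := exists_le_sum i (etrans xs (esym ys)).
have [k /yx lm] := exists_le_sum i (etrans ys (esym xs)).
apply: (mean_productivity_inj (@g_diff i) (g_curved i)) => //.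
by rewrite fl fm; apply/eqP; rewrite eq_le lm ml.
Qed.

Hypothesis g_origin : forall i j : 'I_N, i != j ->
  ((mean_productivity (g j) (X / (N - 1)%:R))%:E
     < mean_productivity0 (g i))%E.

Let K := X / (N - 1)%:R.

Let N1_gt0 : (0 : R) < (N - 1)%:R.
Proof. by rewrite ltr0n subn_gt0. Qed.

Let K_gt0 : 0 < K. Proof. by rewrite divr_gt0. Qed.

(** The strict hypothesis at 0 survives for small [e]: [f j] is continuous at [K], and the possibly
    infinite limit of [f i] is replaced by a value [f i d] with [e < d]. *)
Lemma origin_margin : exists e : R, [/\ 0 < e, e <= K - e *+ 2 &
  forall i j, i != j -> f j (K - e *+ 2) < f i e].
Proof.
suff H : \forall e \near (0 : R)^'+,
    forall i j, i != j -> f j (K - e *+ 2) < f i e.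
  have : \forall e \near (0 : R)^'+, [/\ 0 < e, e <= K - e *+ 2 &
      forall i j, i != j -> f j (K - e *+ 2) < f i e].
    near=> e; split => //; last by near: e.
    suff : e < K / 3 by lra.
    by near: e; apply: nbhs_right_lt; rewrite divr_gt0.
  by move=> /filter_ex.
apply: filter_forall => i; apply: filter_forall => j.
have [<-|ij] := eqVneq i j; first by apply: nearW => e /negP[].
have [d d0 fd] := mean_productivity0_gt (@g_diff i) (g_curved i) (g_origin ij).
have fjK : f j (K - e *+ 2) @[e --> (0 : R)^'+] --> f j K.
  apply: cvg_at_right_filter.
  have -> : f j K = f j (K - 0 *+ 2) by rewrite mul0rn subr0.
  apply: (@continuous_comp _ _ _ (fun e : R => K - e *+ 2) (f j)).
    apply: (@cvgB _ R); first exact: cvg_cst.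
    by apply: (@cvgD _ R); exact: cvg_id.
  rewrite mul0rn subr0.
  exact: (mean_productivity_continuous (@g_diff j) K_gt0).
near=> e => _.
have ed : f i d < f i e.
  by apply: f_lt => //; near: e; exact: nbhs_right_lt.
apply: lt_trans ed.
by near: e; exact: (cvgr_lt _ fjK).
Unshelve. all: by end_near. Qed.

Lemma balanced_budget_exists : exists x : 'rV[R]_N, balanced_budget X g x.
Proof.
have [e [e0 eK fe]] := origin_margin.
have KX : K <= X.
  by rewrite ler_pdivrMr// ler_peMr ?ler1n ?subn_gt0//; exact: ltW.
have eX : e <= X by lra.
have f_cont i x : 0 < x -> {for x, continuous (f i)}.
  exact: (mean_productivity_continuous (@g_diff i)).
pose F i := clamp_extension (f i) e X.
have N0 : (0 < N)%N by exact: ltnW.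
have F_decr i x y : x < y -> F i y < F i x.
  exact: (clamp_extension_decr e0 eX (@f_lt i)).
have [y [c [Fy ys]]] := common_level X N0
  (fun i => clamp_extension_continuous e0 (@f_cont i))
  F_decr
  (fun i => clamp_extension_surj e0 eX (@f_cont i)).
have {}Fy i : F i (y i) = c by exact: Fy.
have FE i x : e <= x <= X -> F i x = f i x.
  by rewrite /F /clamp_extension; case: (clampP eX x) => -[h ->] ?; [
    have -> : x = e by lra | | have -> : x = X by lra]; rewrite subrr subr0.
have ye i : e < y i.
  rewrite ltNge; apply/negP => yie.
  (* Otherwise [c = F j (y j) < f j (K - e *+ 2) < f i e <= F i (y i) = c]. *)
  have yj j : j != i -> y j <= K - e *+ 2.
    move=> ji; rewrite leNgt; apply/negP => /(F_decr j).
    rewrite Fy (FE j); last by apply/andP; split; lra.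
    have /[swap]/lt_trans/[apply] : f j (K - e *+ 2) < f i e.
      by apply: fe; rewrite eq_sym.
    apply/negP; rewrite -leNgt -(FE i) ?lexx// -(Fy i).
    by move: yie; rewrite le_eqVlt => /predU1P[->//|/(F_decr i)/ltW].
  (* The total would be at most [e + X - 2 e (N - 1) <= X - e], as [N - 1 >= 1]. *)
  have : \sum_(j | j != i) y j <= (K - e *+ 2) *+ (N - 1).
    have -> : (N - 1)%N = #|predC1 i| by rewrite cardC1 card_ord subn1.
    by rewrite -sumr_const ler_sum.
  have : X = y i + \sum_(j | j != i) y j by rewrite -ys (bigD1 i).
  have KN : K *+ (N - 1) = X by rewrite -mulr_natr divfK// gt_eqF.
  have e2 : e *+ 2 <= e *+ 2 *+ (N - 1).
    by rewrite -[leLHS]mulr1n ler_wpMn2l ?subn_gt0// mulrn_wge0// ltW.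
  by rewrite mulrnBl KN; lra.
have yX i : y i <= X.
  rewrite -ys (bigD1 i)//= lerDl sumr_ge0// => j _.
  exact/ltW/(lt_trans e0).
have fy i : f i (y i) = c by rewrite -FE ?Fy// ltW//=.
exists (\row_i y i); split; first split => [i|].
- by rewrite mxE; exact: lt_trans (ye i).
- by rewrite -ys; apply: eq_bigr => i _; rewrite mxE.
have c0 : 0 < c.
  pose i0 := Ordinal N0; rewrite -(fy i0).
  apply: (mean_productivity_gt0 (g_prod i0) (@g_diff i0) (g_curved i0)).
  exact: lt_trans (ye i0).
exists c^-1; first by rewrite invr_gt0.
by move=> i; rewrite mxE div1r invrK; exact: fy.
Qed.

End balance.

Theorem mainTheorem2 (R : realType) (N : nat) (X : R) (g : 'I_N -> R -> R)
    (N_ge2 : (2 <= N)%N) (X_gt0 : 0 < X)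
    (g_prod : forall i, productivity_function (g i))
    (g_diff : forall (i : 'I_N) (x : R), 0 < x -> derivable (g i) x 1)
    (g_curved : forall i, curved_at_origin (g i))
    (g_origin : forall i j : 'I_N, i != j ->
      ((mean_productivity (g j) (X / (N - 1)%:R))%:E
         < mean_productivity0 (g i))%E) :
  (exists! xs : 'rV[R]_N, balanced_budget X g xs) /\
  (forall xs : 'rV[R]_N, balanced_budget X g xs ->
   forall x : nat -> 'rV[R]_N,
     positive_budget X (x 0%N) ->
     (forall k : nat, x k.+1 = rule_of_three X g (x k)) ->
     exists C beta : R, [/\ 0 < C, 0 < beta, beta < 1 &
       forall k : nat,
         \big[Num.max/0]_(i < N) `|x k 0 i - xs 0 i| <= C * beta ^+ k]).
Proof.
split.
  have [xs xsb] := balanced_budget_exists N_ge2 X_gt0 g_prod g_diff g_curved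
    g_origin.
  by exists xs; split => // y; exact: balanced_budget_unique.
move=> xs xsb x x0 xS.
have [C [b [C0 b0 b1 H]]] := rule_of_three_geometric X_gt0 g_prod g_diff g_curved
  xsb x0 xS.
(* The maximum starts from 0, so the bound must also be nonnegative. *)
exists C, b; split => // k; apply: bigmax_le => [|i _]; last exact: H.
by rewrite mulr_ge0 ?exprn_ge0// ltW.
Qed.
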